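(* There exist $0$-map graphs which are not contact string graphs.
   Context: All graphs are finite and simple. $0$-map graph: start with a plane graph $G_0$ (a graph embedded in the sphere, equivalently the plane), with each face (including the outer face) labeled a nation or a lake; $G$ is the graph whose vertices are the nations, two distinct vertices being adjacent iff the corresponding faces share a vertex of $G_0$. Equivalently, there is a planar bipartite graph $H$ with bipartition $(X,Y)$ such that $V(G)=X$ and two distinct vertices of $X$ are adjacent in $G$ iff they have a common neighbor in $Y$. A simple curve (string) in $\mathbb{R}^2$ is a subset of $\mathbb{R}^2$ homeomorphic to $[0,1]$; its interior is the curve minus its two endpoints. A contact string graph is the intersection graph of a finite set of simple curves in $\mathbb{R}^2$ whose interiors are pairwise disjoint (vertices are the curves, two distinct ones adjacent iff they intersect). *)

(* Defs.v *)
From mathcomp Require Import all_boot all_order all_algebra.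
From mathcomp Require Import all_classical all_reals all_analysis.

Set Implicit Arguments.
Unset Strict Implicit.
Unset Printing Implicit Defensive.

Import Order.TTheory GRing.Theory Num.Theory.
Import numFieldNormedType.Exports.

Local Open Scope classical_set_scope.
Local Open Scope ring_scope.

Record sgraph := SGraph {
  vertex :> finType;
  adj : rel vertex;
  adj_sym : symmetric adj;
  adj_irrefl : irreflexive adj }.

Arguments adj {s}.

Section Plane.
Variable R : realType.

Notation plane := (R * R)%type.

(* [f] and [g] are mutually inverse homeomorphisms between [0, 1] and [A]; the
   endpoints of the simple curve [A] are p = f 0 and q = f 1. *)
Definition simple_curve (A : set plane) (p q : plane) : Prop :=
  exists (f : R -> plane) (g : plane -> R),
    [/\ {within `[0, 1], continuous f},
        {within A, continuous g},
        (forall t : R, t \in `[0, 1] -> A (f t) /\ g (f t) = t),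
        (forall z, A z -> g z \in `[0, 1] /\ f (g z) = z)
      & f 0 = p /\ f 1 = q].

Definition curve_interior (A : set plane) (p q : plane) : set plane :=
  A `\` [set p; q].

Record plane_graph := PlaneGraph {
  pg_graph :> sgraph;
  pos : pg_graph -> plane;
  edge : pg_graph -> pg_graph -> set plane;
  pos_inj : injective pos;
  edge_sym : forall u v, adj u v -> edge u v = edge v u;
  edge_curve : forall u v, adj u v -> simple_curve (edge u v) (pos u) (pos v);
  edge_avoids_vertices : forall u v w, adj u v ->
    ~ curve_interior (edge u v) (pos u) (pos v) (pos w);
  edge_avoids_edges : forall u v x y, adj u v -> adj x y ->
    (u, v) <> (x, y) -> (u, v) <> (y, x) ->
    curve_interior (edge u v) (pos u) (pos v) `&` edge x y = set0 }.

Definition drawing (G0 : plane_graph) : set plane :=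
  [set z | (exists w : G0, z = pos w) \/
           (exists u v : G0, adj u v /\ edge u v z)].

Definition is_face (G0 : plane_graph) (F : set plane) : Prop :=
  exists2 z, (~` drawing G0) z & F = connected_component (~` drawing G0) z.

(* A face is disjoint from the drawing, so a vertex lies in its closure
   exactly when it lies on its boundary. *)
Definition incident (G0 : plane_graph) (w : G0) (F : set plane) : Prop :=
  closure F (pos w).

(* The nations are the faces in the range of [nation], which identifies them
   with the vertices of [G]; all the other faces are lakes. *)
Definition zero_map_graph (G : sgraph) : Prop :=
  exists (G0 : plane_graph) (nation : G -> set plane),
    [/\ (forall u, is_face G0 (nation u)),
        injective nation
      & forall u v : G, u <> v ->
          (adj u v <->
           exists w : G0, incident w (nation u) /\ incident w (nation v))].

(* Distinct vertices get distinct curves, since the interior of a simple curve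
   is nonempty. *)
Definition contact_string_graph (G : sgraph) : Prop :=
  exists (C : G -> set plane) (p q : G -> plane),
    [/\ (forall u, simple_curve (C u) (p u) (q u)),
        (forall u v, u <> v ->
           curve_interior (C u) (p u) (q u) `&`
           curve_interior (C v) (p v) (q v) = set0)
      & forall u v : G, u <> v -> (adj u v <-> C u `&` C v !=set0)].

End Plane.

(* Main.v *)
Require Import Defs.
From mathcomp Require Import all_boot all_order all_algebra.
From mathcomp Require Import all_classical all_reals all_analysis.
From mathcomp Require Import zify ring lra.

(* The graph is the 9 x 9 king's graph: the nations are the unit squares of a
   plane grid, and two squares are adjacent iff they share a corner.

   It is not a contact string graph by a counting argument.  At any point, all
   but at most one of the strings through it end there, so a clique of k
   strings meeting at a point uses up at least k - 1 of the 2n string ends.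
   Give weight 4 to the diagonal adjacencies and 1 to the others; a clique of
   size k then has total weight at most 4(k - 1), so the total weight is at
   most 4 * 2n = 648.  But there are 128 diagonal and 144 other adjacencies,
   with total weight 656.  Sums over ordered pairs double these numbers. *)

Set Implicit Arguments.
Unset Strict Implicit.
Unset Printing Implicit Defensive.

Import Order.TTheory GRing.Theory Num.Theory.
Import numFieldNormedType.Exports.

Local Open Scope nat_scope.

(** * Counting string ends with weights *)

Definition clique (G : sgraph) (S : {set G}) :=
  {in S &, forall u v, u != v -> adj u v}.

Lemma contact_weight_bound (R : realType) (G : sgraph) (w : G -> G -> nat)
    (c : nat) :
    contact_string_graph R G ->
    (forall u v, ~~ adj u v -> w u v = 0) ->
    (forall S : {set G}, clique S ->
       \sum_(u in S) \sum_(v in S) w u v <= c * #|S|.-1) ->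
  \sum_u \sum_v w u v <= c * (2 * #|G|).
Proof.
move=> [C [p [q [curveC intC adjC]]]] w0 wc.
have pC u : C u (p u).
  have [f [g [_ _ fg _ [<- _]]]] := curveC u.
  by apply: (fg _ _).1; rewrite in_itv /= lexx ler01.
have qC u : C u (q u).
  have [f [g [_ _ fg _ [_ <-]]]] := curveC u.
  by apply: (fg _ _).1; rewrite in_itv /= lexx ler01.
pose Z := undup ([seq p u | u <- enum G] ++ [seq q u | u <- enum G]).
pose S z : {set G} := [set u | `[< C u z >]]%SET.
pose ends z := \sum_u ((z == p u) + (z == q u)).
have inS u z : (u \in S z) -> C u z by rewrite inE => /asboolP.
have Sclique z : clique (S z).
  move=> u v /inS uz /inS vz /eqP uv; apply/adjC => //; by exists z.
have endP u z : C u z -> z != p u -> z != q u ->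
    curve_interior (C u) (p u) (q u) z.
  by move=> Cz /eqP zp /eqP zq; split=> // -[].
(* [T] collects the strings that end at [z]. A string of [S z] outside [T] has [z] in its interior,
   and interiors are disjoint, so there is at most one. *)
have endsS z : #|S z|.-1 <= ends z.
  pose T := [set u | (z == p u) || (z == q u)]%SET.
  have TE : #|T| <= ends z.
    rewrite /ends -sum1_card big_mkcond /= leq_sum // => u _.
    by rewrite inE; case: (z == p u); case: (z == q u).
  have : #|S z :\: T| <= 1.
    apply/card_le1_eqP => u v; rewrite !inE !negb_or.
    move=> /andP[/andP[up uq] /asboolP Cu] /andP[/andP[vp vq] /asboolP Cv].
    apply/eqP/negP => /negP/eqP uv.
    have /seteqP[/(_ z) + _] := intC _ _ uv; apply; split; exact: endP.
  have := cardsID T (S z); have := subset_leq_card (subsetIr (S z) T).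
  lia.
(* A common point of two strings is not interior to both, so it is an end of one of them. Hence the
   finite list [Z] of all ends witnesses every adjacency. *)
have cover u v : adj u v -> exists2 z, z \in Z & (u \in S z) && (v \in S z).
  move=> uv; have nuv : u <> v by move=> e; rewrite e adj_irrefl in uv.
  have [z [uz vz]] := (adjC u v nuv).1 uv.
  exists z; last by rewrite !inE; apply/andP; split; apply/asboolP.
  rewrite mem_undup mem_cat.
  have mp x : z = p x -> z \in [seq p u | u <- enum G].
    by move=> ->; apply: map_f; rewrite mem_enum.
  have mq x : z = q x -> z \in [seq q u | u <- enum G].
    by move=> ->; apply: map_f; rewrite mem_enum.
  case: (eqVneq z (p u)) => [/mp->//|zpu].
  case: (eqVneq z (q u)) => [/mq->//|zqu]; first by rewrite orbT.
  case: (eqVneq z (p v)) => [/mp->//|zpv].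
  case: (eqVneq z (q v)) => [/mq->//|zqv]; first by rewrite orbT.
  have /seteqP[/(_ z) + _] := intC _ _ nuv; case; split; exact: endP.
(* Only an inequality: two strings may meet at several points of [Z], and their weight is then
   counted several times on the right. *)
have le1 : \sum_u \sum_v w u v <=
    \sum_(z <- Z) \sum_(u in S z) \sum_(v in S z) w u v.
  under [leqRHS]eq_bigr do rewrite big_mkcond /=.
  rewrite [leqRHS]exchange_big /=; apply: leq_sum => u _.
  apply: (@leq_trans (\sum_(z <- Z) \sum_v
      if (u \in S z) && (v \in S z) then w u v else 0)); last first.
    apply: leq_sum => z _; case: ifP => _ /=; last by rewrite big1.
    by rewrite [leqRHS]big_mkcond.
  rewrite [leqRHS]exchange_big /=; apply: leq_sum => v _.
  case: (boolP (adj u v)) => [/cover[z zZ uvz]|/w0->//].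
  by rewrite (big_rem z zZ) /= uvz leq_addr.
(* [Z] has no duplicates, so each of the two ends of a string is counted at most once. *)
have le2 : \sum_(z <- Z) ends z <= 2 * #|G|.
  rewrite exchange_big mulnC -sum_nat_const /=; apply: leq_sum => u _.
  have one x : \sum_(z <- Z) (z == x) <= 1.
    rewrite (eq_bigr (fun z => if z == x then 1 else 0)) => [|z _]; last first.
      by case: (z == x).
    by rewrite -big_mkcond sum1_count count_uniq_mem ?undup_uniq ?leq_b1.
  by rewrite big_split /= -[2]/(1 + 1) leq_add.
apply: leq_trans le1 _; apply: (@leq_trans (\sum_(z <- Z) c * ends z)).
  apply: leq_sum => z _; apply: leq_trans (wc _ (Sclique z)) _.
  by rewrite leq_mul2l endsS orbT.
by rewrite -big_distrr /= leq_mul2l le2 orbT.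
Qed.

(** * The king's graph and its weights *)

Definition near_nat (i j : nat) := (i <= j.+1) && (j <= i.+1).

Definition king_adj m (u v : 'I_m * 'I_m) :=
  [&& u != v, near_nat u.1 v.1 & near_nat u.2 v.2].

Lemma king_adj_sym m : symmetric (@king_adj m).
Proof. by move=> u v; rewrite /king_adj /near_nat eq_sym; lia. Qed.

Lemma king_adj_irrefl m : irreflexive (@king_adj m).
Proof. by move=> u; rewrite /king_adj eqxx. Qed.

Definition king_graph m := SGraph (@king_adj_sym m) (@king_adj_irrefl m).

(** A diagonal king's move changes both parities and any other move exactly one, so the weights 4
    and 1 can be read off from parities alone. *)
Definition parity_weight (a b : bool * bool) : nat :=
  if a.1 == b.1 then nat_of_bool (a.2 != b.2) else if a.2 == b.2 then 1 else 4.

Definition parity m (u : 'I_m * 'I_m) := (odd u.1, odd u.2).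

Definition king_weight m (u v : 'I_m * 'I_m) : nat :=
  if king_adj u v then parity_weight (parity u) (parity v) else 0.

Lemma sum_pair (I J : finType) (F : I * J -> nat) :
  \sum_u F u = \sum_i \sum_j F (i, j).
Proof. by rewrite pair_bigA; apply: eq_bigr => -[]. Qed.

(** A check of the 16 subsets. Equality holds for two diagonally opposite classes, 8 = 8 * 1, and
    for all four, 24 = 8 * 3; 4 is the least diagonal weight for which the full square does not
    exceed the rate set by a diagonal pair. *)
Lemma parity_weight_bound (P : {set bool * bool}) :
  \sum_(a in P) \sum_(b in P) parity_weight a b <= 8 * #|P|.-1.
Proof.
have sumE (F : bool * bool -> nat) : \sum_(a in P) F a =
    ((true, true) \in P) * F (true, true)
    + ((true, false) \in P) * F (true, false)
    + ((false, true) \in P) * F (false, true)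
    + ((false, false) \in P) * F (false, false).
  rewrite big_mkcond sum_pair !big_bool /= addnA.
  by do 4! case: (_ \in P); rewrite /= ?mul1n ?mul0n.
rewrite -sum1_card !sumE /parity_weight /=.
by do 4! case: (_ \in P).
Qed.

(* Two squares of a clique differ by at most 1 in each coordinate, so parities
   embed the clique into [bool * bool], compatibly with the weights. *)
Lemma king_clique_weight m (S : {set king_graph m}) : clique S ->
  \sum_(u in S) \sum_(v in S) king_weight u v <= 8 * #|S|.-1.
Proof.
move=> cS.
have pinj : {in S &, injective (@parity m)}.
  move=> [a b] [c d] uS vS; case: (eqVneq (a, b) (c, d)) => // uv [].
  have /and3P[_ /=] := cS _ _ uS vS uv; rewrite /near_nat => ac bd e1 e2.
  by congr (_, _); apply: val_inj => /=; lia.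
have := parity_weight_bound (parity (m:=m) @: S).
rewrite card_in_imset // big_imset //=; apply: leq_trans.
apply: leq_sum => u uS; rewrite big_imset //=; apply: leq_sum => v vS.
by rewrite /king_weight; case: ifP.
Qed.

(** The board size is the least that works: for m >= 1, an m x m board has weight 8(m-1)^2 + 2m(m-1)
    over unordered pairs, which exceeds 8m^2 by 2(m^2 - 9m + 4), first positive at m = 9. *)
Lemma king_weight_total :
  \sum_(u : king_graph 9) \sum_(v : king_graph 9) king_weight u v = 1312.
Proof.
(* The sums over ordinals become folds over [iota 0 9] of a function on natural numbers, which can
   be evaluated. *)
pose f i j k l := if [&& (i, j) != (k, l), near_nat i k & near_nat j l] then
  parity_weight (odd i, odd j) (odd k, odd l) else 0.
pose s F := foldr (fun i n => F i + n) 0 (iota 0 9).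
have sE (F : nat -> nat) : \sum_(i < 9) F i = s F.
  by rewrite -(big_mkord xpredT) unlock /reducebig.
transitivity (s (fun i => s (fun j => s (fun k => s (fun l => f i j k l))))).
  rewrite sum_pair -sE; apply: eq_bigr => i _; rewrite -sE; apply: eq_bigr => j _.
  rewrite sum_pair -sE; apply: eq_bigr => k _; rewrite -sE.
  by apply: eq_bigr => l _.
by vm_compute.
Qed.

(** * The integer grid as a plane graph *)

Definition grid_adj n (u v : 'I_n * 'I_n) :=
  (u.1 == v.1 :> nat) && ((v.2 == u.2.+1 :> nat) || (u.2 == v.2.+1 :> nat)) ||
  (u.2 == v.2 :> nat) && ((v.1 == u.1.+1 :> nat) || (u.1 == v.1.+1 :> nat)).

Lemma grid_adj_sym n : symmetric (@grid_adj n).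
Proof. by move=> u v; rewrite /grid_adj; lia. Qed.

Lemma grid_adj_irrefl n : irreflexive (@grid_adj n).
Proof. by move=> u; rewrite /grid_adj; lia. Qed.

Definition grid_graph n := SGraph (@grid_adj_sym n) (@grid_adj_irrefl n).

Local Open Scope classical_set_scope.
Local Open Scope ring_scope.

Section Grid.
Variable R : realType.
Notation plane := (R * R)%type.

Definition line (P Q : plane) (t : R) : plane :=
  (P.1 + t * (Q.1 - P.1), P.2 + t * (Q.2 - P.2)).

Lemma line_continuous P Q : continuous (line P Q).
Proof.
have affine (a b : R) : continuous (fun t : R => a + t * b).
  move=> t; apply: cvgD; first exact: cvg_cst.
  by apply: cvgM; [exact: cvg_id|exact: cvg_cst].
by move=> t; exact: (cvg_pair (affine P.1 _ t) (affine P.2 _ t)).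
Qed.

Lemma fst_continuous : continuous (fst : plane -> R).
Proof. by move=> z; exact: cvg_fst. Qed.

Lemma snd_continuous : continuous (snd : plane -> R).
Proof. by move=> z; exact: cvg_snd. Qed.

Definition between (a b x : R) := (a <= x <= b) || (b <= x <= a).

(** For points that agree in one coordinate the box degenerates to the segment joining them. Its
    symmetry in [P] and [Q] gives the symmetry of edges. *)
Definition spanned_box (P Q : plane) : set plane :=
  [set z | between P.1 Q.1 z.1 && between P.2 Q.2 z.2].

Lemma spanned_boxC P Q : spanned_box P Q = spanned_box Q P.
Proof.
by apply: eq_set => z; rewrite /between orbC [X in _ && X]orbC.
Qed.

Lemma axis_parallel_curve (P Q : plane) :
    (P.1 = Q.1 /\ (Q.2 = P.2 + 1 \/ P.2 = Q.2 + 1)) \/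
    (P.2 = Q.2 /\ (Q.1 = P.1 + 1 \/ P.1 = Q.1 + 1)) ->
  simple_curve (spanned_box P Q) P Q.
Proof.
case: P Q => [a b] [c d] /= PQ.
(* As [Q - P] is a unit vector, the inner product of [z - P] with it recovers the parameter of
   [z]. *)
exists (line (a, b) (c, d)),
  (fun z => (z.1 - a) * (c - a) + (z.2 - b) * (d - b)); split.
- by apply: continuous_subspaceT; exact: line_continuous.
- apply: continuous_subspaceT => z.
  by apply: cvgD; (apply: cvgM; last exact: cvg_cst); apply: cvgB;
    (try exact: cvg_cst); [exact: fst_continuous|exact: snd_continuous].
- move=> t; rewrite in_itv /= /spanned_box /between /=.
  by case: PQ => -[-> [->|->]] t01; split; lra.
- move=> [x y]; rewrite in_itv /= /spanned_box /between /line /=.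
  by case: PQ => -[-> [->|->]] xy; (split; [lra|congr (_, _); lra]).
- by rewrite /line /=; split; congr (_, _); ring.
Qed.

Variable m : nat.
(** A board of [m] by [m] squares has [m.+1] grid lines in each direction. *)
Let V := grid_graph m.+1.

Definition grid_pos (u : V) : plane := (u.1%:R, u.2%:R).

Definition grid_edge (u v : V) := spanned_box (grid_pos u) (grid_pos v).

Lemma grid_vertexE (u v : V) : u.1 = v.1 :> nat -> u.2 = v.2 :> nat -> u = v.
Proof.
by case: u v => [a b] [c d] /= ac bd; congr (_, _); apply: val_inj.
Qed.

Lemma grid_pos_inj : injective grid_pos.
Proof.
move=> [a b] [c d] [/eqP + /eqP]; rewrite !eqr_nat => /eqP ac /eqP bd.
exact: grid_vertexE.
Qed.

(** Orienting every edge to the right or upwards leaves two shapes of edges to treat instead of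
    four. *)
Definition hstep (u v : V) := v.1 = u.1.+1 :> nat /\ u.2 = v.2 :> nat.
Definition vstep (u v : V) := v.2 = u.2.+1 :> nat /\ u.1 = v.1 :> nat.

Lemma grid_adj_step u v : adj u v ->
  (hstep u v \/ vstep u v) \/ (hstep v u \/ vstep v u).
Proof.
by rewrite /hstep /vstep /= => /orP[] /andP[/eqP e1 /orP[] /eqP e2]; lia.
Qed.

Lemma step_adj u v : hstep u v \/ vstep u v -> adj u v.
Proof. by move=> [] [e1 e2]; rewrite /= /grid_adj e1 e2 !eqxx ?orbT. Qed.

Lemma hstep_edge u v : hstep u v ->
  grid_edge u v = [set z | u.1%:R <= z.1 <= u.1%:R + 1 /\ z.2 = u.2%:R].
Proof.
rewrite /hstep /grid_edge /spanned_box /between /= => -[-> <-].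
by rewrite -natr1; apply/seteqP; split => -[x y] /=; lra.
Qed.

Lemma vstep_edge u v : vstep u v ->
  grid_edge u v = [set z | u.2%:R <= z.2 <= u.2%:R + 1 /\ z.1 = u.1%:R].
Proof.
rewrite /vstep /grid_edge /spanned_box /between /= => -[-> <-].
by rewrite -natr1; apply/seteqP; split => -[x y] /=; lra.
Qed.

Lemma open_unit_natN (i k : nat) : ~ (i%:R < k%:R :> R /\ k%:R < i%:R + 1 :> R).
Proof. by rewrite natr1 !ltr_nat; lia. Qed.

Lemma unit_itv_inj (i j : nat) (t : R) :
  i%:R < t < i%:R + 1 -> j%:R <= t <= j%:R + 1 -> i = j.
Proof.
move=> /andP[it ti] /andP[jt tj].
have : i%:R < j%:R + 1 :> R by lra.
have : j%:R < i%:R + 1 :> R by lra.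
by rewrite !natr1 !ltr_nat; lia.
Qed.

(** An interior point of a grid edge has exactly one non-integer coordinate. A perpendicular edge
    through it would make that coordinate an integer; a parallel one lies on the same grid line and
    over the same unit interval. *)
Lemma step_disjoint u v x y z :
    hstep u v \/ vstep u v -> hstep x y \/ vstep x y ->
    curve_interior (grid_edge u v) (grid_pos u) (grid_pos v) z ->
  grid_edge x y z -> u = x /\ v = y.
Proof.
have split_le (a t : R) : a <= t <= a + 1 -> t != a -> t != a + 1 ->
    a < t < a + 1.
  by move=> /andP[at_ ta] ne1 ne2; rewrite !lt_neqAle at_ ta ne2 eq_sym ne1.
move=> uv xy [].
case: uv => s; [rewrite hstep_edge // | rewrite vstep_edge //].
- case: s => s1 s2 [uz zu] /not_orP[zNu zNv].
  have {uz}uz : u.1%:R < z.1 < u.1%:R + 1.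
    apply: split_le uz _ _; apply/eqP => e.
      by apply: zNu; case: (z) e zu => [? ?] /= -> ->.
    by apply: zNv; case: (z) e zu => [? ?] /= -> ->; rewrite /grid_pos s1 s2 natr1.
  case: xy => t; [rewrite hstep_edge // | rewrite vstep_edge //] => -[xz zx].
    have /eqP := etrans (esym zu) zx; rewrite eqr_nat => /eqP e2.
    have e1 := unit_itv_inj uz xz.
    by case: t => t1 t2; split; apply: grid_vertexE => //; lia.
  by move: uz; rewrite zx => /andP/open_unit_natN.
- case: s => s1 s2 [uz zu] /not_orP[zNu zNv].
  have {uz}uz : u.2%:R < z.2 < u.2%:R + 1.
    apply: split_le uz _ _; apply/eqP => e.
      by apply: zNu; case: (z) e zu => [? ?] /= -> ->.
    by apply: zNv; case: (z) e zu => [? ?] /= -> ->; rewrite /grid_pos s1 s2 natr1.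
  case: xy => t; [rewrite hstep_edge // | rewrite vstep_edge //] => -[xz zx].
    by move: uz; rewrite zx => /andP/open_unit_natN.
  have /eqP := etrans (esym zu) zx; rewrite eqr_nat => /eqP e2.
  have e1 := unit_itv_inj uz xz.
  by case: t => t1 t2; split; apply: grid_vertexE => //; lia.
Qed.

Lemma grid_edge_sym u v : grid_edge u v = grid_edge v u.
Proof. exact: spanned_boxC. Qed.

Lemma grid_edge_curve u v : adj u v ->
  simple_curve (grid_edge u v) (grid_pos u) (grid_pos v).
Proof.
move=> uv; apply: axis_parallel_curve; rewrite /grid_pos /= !natr1.
by move: uv => /grid_adj_step[[]|[]] [-> ->]; tauto.
Qed.

Lemma grid_edge_avoids_vertices u v w : adj u v ->
  ~ curve_interior (grid_edge u v) (grid_pos u) (grid_pos v) (grid_pos w).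
Proof.
move=> uv [uvw] /not_orP[wNu wNv].
have {}wNu : w <> u by move=> wu; apply: wNu; rewrite wu.
have {}wNv : w <> v by move=> wv; apply: wNv; rewrite wv.
move: uvw uv wNu wNv; rewrite /grid_edge /spanned_box /between /= !ler_nat.
move=> uvw /grid_adj_step; rewrite /hstep /vstep => uv wNu wNv.
(* An integer point on a unit edge is one of its ends. *)
have [[e1 e2]|[e1 e2]] : (w.1 = u.1 :> nat /\ w.2 = u.2 :> nat) \/
    (w.1 = v.1 :> nat /\ w.2 = v.2 :> nat).
- by case: u v w uvw uv {wNu wNv} => [a b] [c d] [e f] /=; lia.
- exact/wNu/grid_vertexE.
- exact/wNv/grid_vertexE.
Qed.

Lemma grid_edge_avoids_edges u v x y : adj u v -> adj x y ->
    (u, v) <> (x, y) -> (u, v) <> (y, x) ->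
  curve_interior (grid_edge u v) (grid_pos u) (grid_pos v) `&` grid_edge x y
    = set0.
Proof.
move=> /grid_adj_step uv /grid_adj_step xy ne1 ne2.
apply/seteqP; split => // z [zuv zxy].
have zvu : curve_interior (grid_edge v u) (grid_pos v) (grid_pos u) z.
  by rewrite grid_edge_sym /curve_interior setUC.
have zyx : grid_edge y x z by rewrite grid_edge_sym.
case: uv xy => uv [] xy.
- by have [e1 e2] := step_disjoint uv xy zuv zxy; apply: ne1; rewrite e1 e2.
- by have [e1 e2] := step_disjoint uv xy zuv zyx; apply: ne2; rewrite e1 e2.
- by have [e1 e2] := step_disjoint uv xy zvu zxy; apply: ne2; rewrite e1 e2.
- by have [e1 e2] := step_disjoint uv xy zvu zyx; apply: ne1; rewrite e1 e2.
Qed.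

Definition plane_grid : plane_graph R :=
  PlaneGraph grid_pos_inj (fun u v _ => grid_edge_sym u v) grid_edge_curve
    grid_edge_avoids_vertices grid_edge_avoids_edges.

(** * Unit squares as faces of the grid *)

Definition open_square (i j : nat) : set plane :=
  [set z | i%:R < z.1 < i%:R + 1 /\ j%:R < z.2 < j%:R + 1].

Definition closed_square (i j : nat) : set plane :=
  [set z | i%:R <= z.1 <= i%:R + 1 /\ j%:R <= z.2 <= j%:R + 1].

Definition square_center (i j : nat) : plane := (i%:R + 2^-1, j%:R + 2^-1).

Lemma square_centerP i j : open_square i j (square_center i j).
Proof. by rewrite /open_square /=; lra. Qed.

Lemma open_square_open i j : open (open_square i j).
Proof.
have -> : open_square i j =
    fst @^-1` [set` `]i%:R, i%:R + 1[] `&` snd @^-1` [set` `]j%:R, j%:R + 1[].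
  by apply/seteqP; split => z; rewrite /= !in_itv.
apply: openI; apply: open_comp; try exact: interval_open.
  by move=> z _; exact: fst_continuous.
by move=> z _; exact: snd_continuous.
Qed.

Lemma closed_square_closed i j : closed (closed_square i j).
Proof.
have -> : closed_square i j =
    fst @^-1` [set` `[i%:R, i%:R + 1]] `&` snd @^-1` [set` `[j%:R, j%:R + 1]].
  by apply/seteqP; split => z; rewrite /= !in_itv.
apply: closedI; apply: closed_comp; try exact: interval_closed.
  by move=> z _; exact: fst_continuous.
by move=> z _; exact: snd_continuous.
Qed.

Lemma open_square_sub i j : open_square i j `<=` closed_square i j.
Proof. by move=> z [] /andP[? ?] /andP[? ?]; split; lra. Qed.

(** A convex combination that gives positive weight to an interior point is interior. This serves
    for both the closure and the connectedness of the open square. *)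
Lemma line_open_square i j P Q t : closed_square i j P -> open_square i j Q ->
  0 < t <= 1 -> open_square i j (line P Q t).
Proof.
case: P Q => [a b] [c d]; rewrite /closed_square /open_square /line /=.
by move=> [? ?] [? ?] ?; split; nra.
Qed.

Lemma closure_open_square i j : closure (open_square i j) = closed_square i j.
Proof.
apply/seteqP; split.
  rewrite [X in _ `<=` X](closure_id _).1; last exact: closed_square_closed.
  exact: closure_subset (@open_square_sub i j).
move=> P iP U PU; pose c := square_center i j.
(* [P] is approached along the segment towards the center. *)
have Uline : \forall t \near 0^'+, U (line P c t).
  apply: cvg_within; apply: (@line_continuous P c 0).
  by rewrite /line !mul0r !addr0 -surjective_pairing.
near (0 : R)^'+ => t.
exists (line P c t); split; last by near: t.
apply: line_open_square iP (square_centerP i j) _.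
by apply/andP; split; near: t; [exact: nbhs_right_gt|exact: nbhs_right_le].
Unshelve. all: by end_near.
Qed.

Lemma open_square_connected i j : connected (open_square i j).
Proof.
pose c := square_center i j.
(* The square is star-shaped: it is a union of segments ending at the center. *)
have -> : open_square i j =
    \bigcup_(P in open_square i j) [set line P c t | t in `[0, 1]].
  apply/seteqP; split => [P iP|_ [P iP [t /= t01 <-]]].
    exists P => //; exists 0; first by rewrite /= in_itv /= lexx ler01.
    by rewrite /line !mul0r !addr0 -surjective_pairing.
  move: t01; rewrite in_itv /= le_eqVlt => /andP[/orP[/eqP<-|t0] t1].
    by rewrite /line !mul0r !addr0 -surjective_pairing.
  apply: line_open_square (square_centerP i j) _; last by rewrite t0.
  exact: open_square_sub.
apply: bigcup_connected.
  exists c => P iP; exists 1; first by rewrite /= in_itv /= lexx ler01.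
  by rewrite /line !mul1r !subrKC.
move=> P _; apply: connected_continuous_connected; first exact: segment_connected.
by apply: continuous_subspaceT; exact: line_continuous.
Qed.

(** Every point of the drawing has an integer coordinate, while a point of an open unit square has
    none. *)
Lemma open_square_drawing i j :
  open_square i j `<=` ~` drawing plane_grid.
Proof.
move=> z [z1 z2] [[w zw]|[u [v [uv]]]].
  by move: z1; rewrite zw /= => /andP/open_unit_natN.
have : grid_edge v u = grid_edge u v by rewrite grid_edge_sym.
rewrite /edge /= => e.
have [[]|[]] := grid_adj_step uv => s.
- by rewrite hstep_edge // => -[_ zu]; move: z2; rewrite zu => /andP/open_unit_natN.
- by rewrite vstep_edge // => -[_ zu]; move: z1; rewrite zu => /andP/open_unit_natN.
- by rewrite -e hstep_edge // => -[_ zu]; move: z2; rewrite zu => /andP/open_unit_natN.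
- by rewrite -e vstep_edge // => -[_ zu]; move: z1; rewrite zu => /andP/open_unit_natN.
Qed.

Lemma horizontal_drawing (i j : nat) (z : plane) : (i < m)%N -> (j <= m)%N ->
  i%:R <= z.1 <= i%:R + 1 -> z.2 = j%:R -> drawing plane_grid z.
Proof.
move=> im jm z1 z2; right; pose u : V := (inord i, inord j).
pose v : V := (inord i.+1, inord j).
have uv : hstep u v by rewrite /hstep /= !inordK // ltnS ltnW.
exists u, v; split; first by apply: step_adj; left.
by rewrite /edge /= hstep_edge //= !inordK // ltnS ltnW.
Qed.

Lemma vertical_drawing (i j : nat) (z : plane) : (i <= m)%N -> (j < m)%N ->
  j%:R <= z.2 <= j%:R + 1 -> z.1 = i%:R -> drawing plane_grid z.
Proof.
move=> im jm z1 z2; right; pose u : V := (inord i, inord j).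
pose v : V := (inord i, inord j.+1).
have uv : vstep u v by rewrite /vstep /= !inordK // ltnS ltnW.
exists u, v; split; first by apply: step_adj; right.
by rewrite /edge /= vstep_edge //= !inordK // ltnS ltnW.
Qed.

(** The bounds on [i] and [j] make all four sides of the square edges of the grid, so a point off
    the drawing lies on no side. *)
Lemma closed_square_drawing i j z : (i < m)%N -> (j < m)%N ->
  closed_square i j z -> ~ drawing plane_grid z -> open_square i j z.
Proof.
move=> im jm [z1 z2] zG.
have ne1 : z.1 != i%:R.
  by apply/eqP => e; apply/zG/(vertical_drawing (ltnW im) jm z2 e).
have ne2 : z.1 != i%:R + 1.
  by apply/eqP; rewrite natr1 => e; apply/zG/(vertical_drawing im jm z2 e).
have ne3 : z.2 != j%:R.
  by apply/eqP => e; apply/zG/(horizontal_drawing im (ltnW jm) z1 e).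
have ne4 : z.2 != j%:R + 1.
  by apply/eqP; rewrite natr1 => e; apply/zG/(horizontal_drawing im jm z1 e).
move: z1 z2 => /andP[? ?] /andP[? ?].
by split; rewrite !lt_neqAle ?ne2 ?ne4 eq_sym ?ne1 ?ne3; apply/andP.
Qed.

Lemma open_square_face (i j : nat) : (i < m)%N -> (j < m)%N ->
  is_face plane_grid (open_square i j).
Proof.
move=> im jm; have c := square_centerP i j.
have cG := open_square_drawing c.
exists (square_center i j) => //; apply/seteqP; split.
  apply: connected_component_max => //; first exact: open_square_drawing.
  exact: open_square_connected.
set A := connected_component _ _.
have AG : A `<=` ~` drawing plane_grid by exact: connected_component_sub.
(* The square is open, and within [A] it coincides with the closed square, so it cuts out a nonempty
   clopen part of the connected set [A]. *)
suff <- : A `&` open_square i j = A by move=> z [].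
apply: component_connected.
- by exists (square_center i j); split => //; exact: connected_component_refl.
- by exists (open_square i j) => //; exact: open_square_open.
- exists (closed_square i j); first exact: closed_square_closed.
  apply/seteqP; split => z [Az iz]; split => //; first exact: open_square_sub.
  by apply: closed_square_drawing iz (AG _ Az).
Qed.

End Grid.

(** * The king's graph separates the two classes *)

Lemma open_square_inj (R : realType) (i j k l : nat) :
  open_square i j = open_square k l :> set (R * R) -> i = k /\ j = l.
Proof.
move=> e; have := square_centerP R k l; rewrite -e => /open_square_sub[].
have [c1 c2] := square_centerP R k l.
by move=> /(unit_itv_inj c1) -> /(unit_itv_inj c2) ->.
Qed.

Lemma king_graph_zero_map (R : realType) m : zero_map_graph R (king_graph m).
Proof.
exists (plane_grid R m), (fun u : king_graph m => @open_square R u.1 u.2).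
have incP (w : plane_grid R m) i j : incident w (@open_square R i j) <->
    (i <= w.1 <= i.+1 /\ j <= w.2 <= j.+1)%N.
  rewrite /incident closure_open_square /closed_square /=.
  by rewrite !natr1 !ler_nat.
split=> [u|[a b] [c d] /open_square_inj [] /= ac bd|[a b] [c d] ne].
- exact: open_square_face.
- by congr (_, _); apply: val_inj.
rewrite /= /king_adj /near_nat; move/eqP: ne => -> /=; split.
  (* If [a] and [c] differ by at most 1, their maximum lies in both [[a, a + 1]] and [[c, c + 1]];
     likewise for [b] and [d]. This gives a common corner. *)
  move=> /andP[ac bd]; exists (inord (maxn a c), inord (maxn b d)).
  have := ltn_ord a; have := ltn_ord b; have := ltn_ord c; have := ltn_ord d.
  move=> dm cm bm am; rewrite !incP /= !inordK ?ltnS ?geq_max; lia.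
by move=> [[x y]]; rewrite !incP /=; lia.
Qed.

Lemma king_graph_not_contact (R : realType) :
  ~ contact_string_graph R (king_graph 9).
Proof.
move=> contact.
have : (1312 <= 8 * (2 * #|king_graph 9|))%N.
  rewrite -king_weight_total; apply: contact_weight_bound contact _ _;
    last exact: king_clique_weight.
  by move=> u v; rewrite /king_weight /=; case: ifP.
(* The right-hand side is 8 * 2 * 81 = 1296, less than 1312. *)
by rewrite /= card_prod card_ord.
Qed.

Theorem proposition3p10 (R : realType) :
  exists G : sgraph, zero_map_graph R G /\ ~ contact_string_graph R G.
Proof.
exists (king_graph 9); split; first exact: king_graph_zero_map.
exact: king_graph_not_contact.
Qed.
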